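(* For every meager set $F\subseteq 2^\omega$ and every Silver tree $T\subseteq 2^{<\omega}$ there is a Silver tree $T'\subseteq T$ such that for every $n\in\omega$ the set $$F+\underbrace{[T']+[T']+\dots+[T']}_{n\text{ times}}$$ is meager in $2^\omega$.
   Context: A tree is a nonempty set $T\subseteq 2^{<\omega}$ closed under initial segments. Write $\mathrm{split}(T)=\{\sigma\in T:\sigma^\frown 0\in T\text{ and }\sigma^\frown 1\in T\}$ and $[T]=\{x\in 2^\omega:(\forall n\in\omega)\ x\upharpoonright n\in T\}$. $T$ is perfect if for every $\sigma\in T$ there is $\tau\in\mathrm{split}(T)$ with $\sigma\subseteq\tau$. $T$ is a Silver tree if it is perfect and for all $\sigma,\tau\in T$ with $|\sigma|=|\tau|$ and all $i\in\{0,1\}$: $\sigma^\frown i\in T\iff\tau^\frown i\in T$. On $2^\omega$, $+$ is coordinatewise addition modulo $2$, and $A+B=\{a+b:a\in A,\ b\in B\}$ for $A,B\subseteq 2^\omega$; for $n=0$ the displayed set is read as $F$ itself. *)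

(* Defs.v *)
From mathcomp Require Import all_boot.
From mathcomp Require Import boolp classical_sets topology cantor.

Set Implicit Arguments.
Unset Strict Implicit.
Unset Printing Implicit Defensive.

Local Open Scope classical_set_scope.

(* Finite binary sequences are [seq bool], with [false] for 0 and [true] for 1;
   points of 2^omega are elements of [cantor_space]. *)

Definition is_tree (T : set (seq bool)) : Prop :=
  T !=set0 /\ forall s t : seq bool, prefix s t -> T t -> T s.

Definition split_nodes (T : set (seq bool)) : set (seq bool) :=
  [set s | [/\ T s, T (rcons s false) & T (rcons s true)]].

(* [mkseq x n] is the restriction of [x] to [n]. *)
Definition branches (T : set (seq bool)) : set cantor_space :=
  [set x | forall n : nat, T (mkseq x n)].

Definition perfect_tree (T : set (seq bool)) : Prop :=
  is_tree T /\
  forall s, T s -> exists2 t, split_nodes T t & prefix s t.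

Definition silver_tree (T : set (seq bool)) : Prop :=
  perfect_tree T /\
  forall s t, T s -> T t -> size s = size t ->
  forall i : bool, T (rcons s i) <-> T (rcons t i).

Definition cantor_add (x y : cantor_space) : cantor_space :=
  fun k => x k (+) y k.

Definition sumset (A B : set cantor_space) : set cantor_space :=
  [set cantor_add a b | a in A & b in B].

(* F + B + ... + B with n summands B, associated to the left. *)
Definition add_sumset (F B : set cantor_space) (n : nat) : set cantor_space :=
  iter n (fun A => sumset A B) F.

Definition nowhere_dense (X : topologicalType) (A : set X) : Prop :=
  interior (closure A) = set0.

Definition meager (X : topologicalType) (A : set X) : Prop :=
  exists2 N : nat -> set X,
    (forall k, nowhere_dense (N k)) & A = \bigcup_k N k.

(* Main.v *)
Require Import Defs.
From mathcomp Require Import all_boot.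
From mathcomp Require Import boolp classical_sets topology cantor.

(** A Silver tree is a point [x] together with an infinite set of free levels:
    its branches are the points that agree with [x] off the free levels. So
    adding branches of a Silver tree with free levels [A] to [f] any number of
    times only translates [f] by a fixed point and then changes it on [A] in an
    arbitrary way ([add_sumset_off]). It is therefore enough to thin the free
    levels of [T] to an infinite set [A] such that arbitrary changes on [A] and
    translations preserve the meagerness of [F].

    A meager set is covered by nowhere dense sets [N i]. Given a position [m],
    there are finitely many prefixes of length [m], so one word [w] can be
    extended prefix by prefix until no point of [N 0], ..., [N k] has [w] at
    position [m], whatever it does before [m] ([avoid_block]). Placing such
    words alternately with single points of the given infinite set of levels
    gives positions [m k], words [w k] and an infinite set [A] disjoint from
    all the blocks where these words are placed ([sparse_subset]). Each point of
    [F] has only finitely many of the [w k] in place; changes on [A] do not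
    touch the blocks, and a translation by [z] merely replaces [w k] by
    [w k + z]. A set whose points all eventually avoid prescribed words on
    blocks going to infinity is meager ([meager_avoid_blocks]). *)

Set Implicit Arguments.
Unset Strict Implicit.
Unset Printing Implicit Defensive.

Local Open Scope classical_set_scope.

(** * Words occurring in points, and nowhere dense sets *)

(** At position 0 this describes the basic open set of extensions of [w]; later
    positions describe the blocks on which points are compared with words. *)
Definition occurs (x : cantor_space) (m : nat) (w : seq bool) : Prop :=
  map x (iota m (size w)) = w.

Lemma occurs_map (x : cantor_space) m n : occurs x m (map x (iota m n)).
Proof. by rewrite /occurs size_map size_iota. Qed.

Lemma occurs_cat x m s t :
  occurs x m (s ++ t) <-> occurs x m s /\ occurs x (m + size s) t.
Proof.
rewrite /occurs size_cat iotaD map_cat; split=> [/eqP|[-> ->] //].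
by rewrite eqseq_cat ?size_map ?size_iota // => /andP[/eqP-> /eqP->].
Qed.

Lemma occurs_nth x m w :
  occurs x m w <-> forall i, i < size w -> x (m + i) = nth false w i.
Proof.
split=> [xw i iw|xw].
  by rewrite -[w in RHS]xw (nth_map 0) ?size_iota // nth_iota.
apply: (@eq_from_nth _ false); rewrite size_map size_iota // => i iw.
by rewrite (nth_map 0) ?size_iota // nth_iota // xw.
Qed.

Lemma nbhs_occurs (x : cantor_space) s :
  occurs x 0 s -> nbhs x [set y | occurs y 0 s].
Proof.
elim/last_ind: s => [|s b IHs] /=.
  by move=> _; apply: filterS filterT => y _.
rewrite -cats1 occurs_cat => -[/IHs xs xb].
have xn : nbhs x [set y : cantor_space | y (size s) = x (size s)].
  exact: (@proj_continuous nat (fun=> bool) (size s) x _ (discrete_set1 _)).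
apply: filterS (filterI xs xn) => y [ys yn].
apply/occurs_cat; split=> //.
by move: xb; rewrite /occurs /= yn.
Qed.

(** The filter generated by the cylinders around [x] converges to [x] at every
    coordinate, hence in the product topology. *)
Lemma nbhs_sub_cylinder (x : cantor_space) (U : set cantor_space) :
  nbhs x U -> exists n, forall y, occurs y 0 (map x (iota 0 n)) -> U y.
Proof.
pose cyl n := [set y : cantor_space | occurs y 0 (map x (iota 0 n))].
pose G := filter_from setT cyl.
have cylS i j : i <= j -> cyl j `<=` cyl i.
  by move=> ij y; rewrite /cyl /= -(subnKC ij) iotaD map_cat => /occurs_cat[].
have GF : Filter G.
  apply: filter_from_filter; first by exists 0.
  move=> i j _ _; exists (maxn i j) => // y yc.
  by split; apply: cylS yc; rewrite ?leq_maxl ?leq_maxr.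
have cvx : {ptws, G --> x}.
  apply/pointwise_cvgP => t; apply/discrete_cvg; exists t.+1 => // y.
  move=> /occurs_nth /(_ t).
  by rewrite size_map size_iota (nth_map 0) ?size_iota ?nth_iota //=; exact.
by move=> /cvx[n _ nU]; exists n => y /nU.
Qed.

(** Cylinders form a base of the topology, so nowhere density can be tested on
    them; all later arguments use only this combinatorial form. *)
Lemma nowhere_denseP (A : set cantor_space) :
  nowhere_dense A <->
  forall s, exists t, forall x, A x -> ~ occurs x 0 (s ++ t).
Proof.
split=> [ndA s|cylA].
  have [x [xs xA]] : exists x, occurs x 0 s /\ ~ closure A x.
    apply: contrapT => /forallNP noA.
    suff : (closure A)° (nth false s : cantor_space) by rewrite ndA.
    (* Otherwise the cylinder of [s], a neighbourhood of [s] padded with zeros,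
       would lie in the closure of [A]. *)
    have xs : occurs (nth false s) 0 s by apply/occurs_nth.
    apply: filterS (nbhs_occurs xs) => y ys.
    by apply: contrapT => yA; apply: (noA y).
  have [U xU AU] : exists2 U, nbhs x U & A `&` U = set0.
    apply: contrapT => noU; apply: xA => U xU; apply/set0P/eqP => AU0.
    by apply: noU; exists U.
  have [n nU] := nbhs_sub_cylinder xU.
  (* [s] is a prefix of [x], so this extends [s] to the prefix of [x] of length
     [size s + n], which is long enough to force membership in [U]. *)
  exists (map x (iota (size s) n)) => y Ay ys.
  suff : (A `&` U) y by rewrite AU.
  split=> //; apply: nU; move: ys.
  rewrite -{1}xs -map_cat -iotaD addnC iotaD map_cat.
  by move=> /occurs_cat[].
rewrite /nowhere_dense -subset0 => x /nbhs_sub_cylinder[n nA].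
have [t tA] := cylA (map x (iota 0 n)).
set s := _ ++ t in tA.
have ys : occurs (nth false s) 0 s by apply/occurs_nth.
have /occurs_cat[/nA yA _] := ys.
by have [y [/tA]] := yA _ (nbhs_occurs ys).
Qed.

Lemma nowhere_dense_sub (A B : set cantor_space) :
  A `<=` B -> nowhere_dense B -> nowhere_dense A.
Proof.
move=> AB /nowhere_denseP ndB; apply/nowhere_denseP => s.
by have [t tB] := ndB s; exists t => x /AB/tB.
Qed.

Lemma meager_sub_bigcup (A : set cantor_space) (N : nat -> set cantor_space) :
  (forall k, nowhere_dense (N k)) -> A `<=` \bigcup_k N k -> meager A.
Proof.
move=> ndN AN; exists (fun k => A `&` N k).
  by move=> k; apply: nowhere_dense_sub (ndN k) => x [].
by rewrite -setI_bigcupr; apply/esym/setIidPl.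
Qed.

(** * Blocks avoided by the points of a meager set *)

(** A single word handles all the pairs of a prefix of length [m] and an index
    [i <= k]: treat these finitely many pairs one after the other, each time
    lengthening the word, since what has been avoided stays avoided. *)
Lemma avoid_block (N : nat -> set cantor_space) m k :
  (forall i, nowhere_dense (N i)) ->
  exists w, forall i x, i <= k -> N i x -> ~ occurs x m w.
Proof.
move=> ndN.
have avoid (L : seq (seq bool * nat)) :
  exists w, forall p, p \in L -> forall x, N p.2 x -> ~ occurs x 0 (p.1 ++ w).
  elim: L => [|p L [w wL]]; first by exists [::].
  have /nowhere_denseP/(_ (p.1 ++ w))[u pu] := ndN p.2.
  exists (w ++ u) => q; rewrite inE catA => /predU1P[-> //|qL] x Nx.
  by move=> /occurs_cat[]; move: Nx => /(wL _ qL).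
have [w wL] := avoid [seq (val s, i) | s <- enum {:m.-tuple bool},
                                      i <- iota 0 k.+1].
exists w => i x ik Nx xw.
pose s := [tuple of map x (iota_tuple m 0)].
apply: (wL (val s, i) _ x Nx).
  by apply/allpairsP; exists (s, i); rewrite mem_enum mem_iota.
apply/occurs_cat; split; first exact: occurs_map.
by rewrite size_tuple.
Qed.

Definition unbounded (A : set nat) : Prop := forall b, exists2 a, A a & b <= a.

(** The blocks from [m k] to [m k + size (w k)] are built one after the other.
    Between the end of a block and the start of the next one, one element of
    [A] is put into [A']; as nothing else is put in, [A'] misses the blocks. *)
Lemma sparse_subset (N : nat -> set cantor_space) (A : set nat) :
    (forall i, nowhere_dense (N i)) -> unbounded A ->
  exists (A' : set nat) (m : nat -> nat) (w : nat -> seq bool),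
    [/\ A' `<=` A, unbounded A', (forall k, k <= m k),
        (forall k i, i < size (w k) -> ~ A' (m k + i)) &
        (forall k i x, i <= k -> N i x -> ~ occurs x (m k) (w k))].
Proof.
move=> ndN Aoo.
have /choice[h /all_and2[hA hb]] : forall b, exists a, A a /\ b <= a.
  by move=> b; have [a] := Aoo b; exists a.
have /choice[W WN] (p : nat * nat) := avoid_block p.1 p.2 ndN.
pose next k p := h (p + size (W (p, k))).
pose m := fix m k := if k is k'.+1 then (next k' (m k')).+1 else 0.
pose w k := W (m k, k).
have endS k : m k + size (w k) < m k.+1 by rewrite ltnS; exact: hb.
have mS k : m k < m k.+1 by apply: leq_ltn_trans (endS k); rewrite leq_addr.
have km k : k <= m k by elim: k => // k IHk; exact: leq_ltn_trans (mS k).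
have mono : {homo m : i j / i <= j}.
  by apply: homo_leq => // [|k]; [exact: leq_trans | exact: ltnW].
(* [next k (m k)] is the chosen element of [A] past block [k], and block [k.+1]
   starts right after it. *)
exists (range (fun k => next k (m k))), m, w; split=> //.
- by move=> _ [k _ <-]; exact: hA.
- move=> b; exists (next b (m b)); first by exists b.
  by rewrite -ltnS; apply: leq_trans (km b.+1).
- move=> k i iw [j _ ji]; have [jk|kj] := ltnP j k.
    by have := mono _ _ jk; rewrite /= ji ltnNge leq_addr.
  have : m k + size (w k) <= m k + i.
    rewrite -ji; apply: leq_trans (hb _).
    move: kj; rewrite leq_eqVlt => /predU1P[-> //|kj].
    apply: leq_trans (ltnW (endS k)) _.
    exact: leq_trans (mono _ _ kj) (leq_addr _ _).
  by rewrite leq_add2l leqNgt iw.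
- by move=> k; exact: (WN (m k, k)).
Qed.

(** The points avoiding all the words from the [j]-th one on form a nowhere
    dense set: any finite sequence can be padded up to some later block and
    then completed by the forbidden word. *)
Lemma meager_avoid_blocks (B : set cantor_space) m (w : nat -> seq bool) :
    (forall k, k <= m k) ->
    (forall x, B x -> exists j, forall k, j <= k -> ~ occurs x (m k) (w k)) ->
  meager B.
Proof.
move=> km Bw.
pose E j := [set x | forall k, j <= k -> ~ occurs x (m k) (w k)].
apply: (@meager_sub_bigcup _ E) => [j|x /Bw[j xj]]; last by exists j.
apply/nowhere_denseP => s; pose k := maxn j (size s).
exists (nseq (m k - size s) false ++ w k) => x /(_ k (leq_maxl _ _)) xw.
rewrite catA => /occurs_cat[_]; rewrite size_cat size_nseq add0n subnKC //.
exact: leq_trans (leq_maxr j _) (km k).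
Qed.

(** * Sums with the branches of a Silver tree *)

(** The translation [z] is the [n]-fold sum of [x]; it does not depend on the
    branches chosen, and what they do on [A] is forgotten. *)
Lemma add_sumset_off (F B : set cantor_space) (A : set nat)
    (x : cantor_space) n :
    (forall y, B y -> forall k, ~ A k -> y k = x k) ->
  exists z : cantor_space, forall y, add_sumset F B n y ->
    exists2 f, F f & forall k, ~ A k -> y k = f k (+) z k.
Proof.
move=> Bx; elim: n => [|n [z zn]].
  by exists (fun=> false) => y Fy; exists y => // k _; rewrite addbF.
exists (cantor_add z x) => _ [a /zn[f Ff fa] [b /Bx bx <-]].
by exists f => // k Ak; rewrite /cantor_add fa // bx // addbA.
Qed.

(** The Silver tree with branch [x] and free levels [A]. *)
Definition silver_of (x : cantor_space) (A : set nat) : set (seq bool) :=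
  [set s | forall k, k < size s -> ~ A k -> nth false s k = x k].

Lemma silver_of_rcons x A s b :
  silver_of x A (rcons s b) <->
  silver_of x A s /\ (~ A (size s) -> b = x (size s)).
Proof.
split=> [sb|[xs xb] k].
  split=> [k ks Ak|As].
    by rewrite -(sb k) ?nth_rcons ?ks // size_rcons ltnW.
  by rewrite -(sb (size s)) ?nth_rcons ?ltnn ?eqxx // size_rcons.
rewrite size_rcons ltnS leq_eqVlt nth_rcons => /predU1P[->|ks].
  by rewrite ltnn eqxx.
by rewrite ks; exact: xs.
Qed.

Lemma silver_tree_of x A : unbounded A -> silver_tree (silver_of x A).
Proof.
move=> Aoo; split; first split; first split.
- by exists [::].
- move=> s t /prefixP[u ->] xt k ks Ak.
  by rewrite -(xt k) ?nth_cat ?ks // size_cat ltn_addr.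
- move=> s xs; have [a Aa sa] := Aoo (size s).
  pose t := s ++ map x (iota (size s) (a - size s)).
  have ta : size t = a by rewrite size_cat size_map size_iota subnKC.
  have xt : silver_of x A t.
    move=> k; rewrite ta nth_cat => ka Ak; case: ltnP => [ks|sk].
      exact: xs.
    by rewrite (nth_map 0) ?size_iota ?ltn_sub2r ?(leq_ltn_trans sk) //
               nth_iota ?ltn_sub2r ?(leq_ltn_trans sk) // subnKC.
  exists t; last exact: prefix_prefix.
  by split=> //; apply/silver_of_rcons; rewrite ta.
- by move=> s t xs xt st i; rewrite !silver_of_rcons st; split=> -[].
Qed.

Lemma branches_silver_of x A y :
  branches (silver_of x A) y -> forall k, ~ A k -> y k = x k.
Proof.
by move=> xy k; have := xy k.+1 k; rewrite size_mkseq nth_mkseq //; exact.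
Qed.

Definition split_levels (T : set (seq bool)) : set nat :=
  [set n | exists2 s, split_nodes T s & size s = n].

(** By the Silver property, whether a node of [T] has a given child depends only
    on its level: at a level of [A] both children are in [T], and elsewhere the
    child that [x] follows is. *)
Lemma silver_of_sub T x A : silver_tree T -> branches T x ->
  A `<=` split_levels T -> silver_of x A `<=` T.
Proof.
move=> [_ sT] Tx AT; elim/last_ind => [_|s b IHs]; first exact: (Tx 0).
move=> /silver_of_rcons[/IHs Ts sb].
have [/AT[t [Tt Tt0 Tt1] st]|/sb ->] := pselect (A (size s)).
  by apply/(sT _ _ Tt Ts st); case: b {sb}.
have := Tx (size s).+1; rewrite -[X in mkseq _ X]addn1 /mkseq.
rewrite iotaD map_cat cats1.
by move/(sT _ _ (Tx _) Ts); apply; rewrite size_mkseq.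
Qed.

(** Perfectness provides every node with a proper extension, so a choice of
    children leads from the root along a branch. *)
Lemma perfect_tree_branch T : perfect_tree T -> exists x, branches T x.
Proof.
move=> [[[s0 Ts0] pT] sT].
have next s : exists b, T s -> T (rcons s b).
  have [/sT[t [Tt Tt0 _]]|] := pselect (T s); last by exists false.
  move=> /prefixP[[|b u] tE]; last first.
    by exists b => _; apply: pT Tt; rewrite tE -cat_rcons; exact: prefix_prefix.
  by exists false => _; rewrite tE cats0 in Tt0.
have [f fT] := choice next.
pose node := fix node n :=
  if n is n'.+1 then rcons (node n') (f (node n')) else [::].
exists (f \o node) => n.
have -> : mkseq (f \o node) n = node n.
  by elim: n => // n IHn; rewrite -[n.+1]addn1 /mkseq iotaD map_cat cats1
    -/(mkseq _ _) IHn addn1.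
by elim: n => [|n IHn] /=; [apply: pT Ts0; exact: prefix0s | exact: fT].
Qed.

Lemma split_levels_unbounded T : perfect_tree T -> unbounded (split_levels T).
Proof.
move=> pT b; have [x Tx] := perfect_tree_branch pT.
have [t Tt /prefixP[u tE]] := pT.2 _ (Tx b).
by exists (size t); [exists t | rewrite tE size_cat size_mkseq leq_addr].
Qed.

Theorem theorem5 (F : set cantor_space) (T : set (seq bool)) :
  meager F -> silver_tree T ->
  exists T' : set (seq bool),
    [/\ silver_tree T', T' `<=` T &
        forall n : nat, meager (add_sumset F (branches T') n)].
Proof.
move=> [N ndN ->] sT; have [pT _] := sT.
have [x Tx] := perfect_tree_branch pT.
have [A [m [w [AT Aoo km Aw Nw]]]] :=
  sparse_subset ndN (split_levels_unbounded pT).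
exists (silver_of x A); split=> [||n].
- exact: silver_tree_of.
- exact: silver_of_sub AT.
have [z zF] := add_sumset_off (\bigcup_k N k) n (@branches_silver_of x A).
(* If [y] is [f + z] off [A], then [w k + z] occurs in [y] at [m k] exactly when
   [w k] occurs in [f], because [A] misses the block. *)
pose wz k := mkseq (fun i => nth false (w k) i (+) z (m k + i)) (size (w k)).
apply: (@meager_avoid_blocks _ m wz km) => y /zF[f [j _ Nf] yf].
exists j => k jk /occurs_nth; rewrite size_mkseq => yw.
apply: (Nw k j f jk Nf); apply/occurs_nth => i iw.
apply: (@addIb (z (m k + i))); rewrite -yf ?yw ?nth_mkseq //.
exact: Aw.
Qed.
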